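(* Let $H$ be a weakly nilpotent hypergroup and let $N$ be a closed subset of $H$. Then $N$ (a hypergroup under the hypermultiplication of $H$ restricted to $N$) is weakly nilpotent.
   Context: A hypergroup is a set $H$ with a hypermultiplication, i.e. a map $H\times H\to \mathcal P(H)$, $(p,q)\mapsto pq$ (the power set of $H$), where for subsets $P,Q\subseteq H$ one puts $PQ:=\bigcup_{p\in P,q\in Q}pq$, and $pQ:=\{p\}Q$, $Qp:=Q\{p\}$, such that: (i) $p(qr)=(pq)r$ for all $p,q,r\in H$; (ii) there is an element $1\in H$ with $s1=\{s\}$ for all $s\in H$; (iii) for each $s\in H$ there is an element $s^*\in H$ such that for all $p,q,r\in H$ with $r\in pq$ one has $q\in p^*r$ and $p\in rq^*$. A singleton $\{s\}$ is sometimes written $s$. For $S\subseteq H$, $S^*:=\{s^*: s\in S\}$. A nonempty subset $F\subseteq H$ is closed if $F^*F\subseteq F$; a closed subset is itself a hypergroup under the restricted hypermultiplication. A closed subset $F$ of $H$ is normal in $H$ if $Fh\subseteq hF$ for all $h\in H$. Quotient: for a closed subset $F$ of $H$ and $h\in H$ put $h^F:=FhF$, and for $F\subseteq S\subseteq H$ put $S//F:=\{h^F: h\in S\}$. With $a^F\cdot b^F:=\{x^F: x\in aFb\}$ the set $H//F$ is a hypergroup, with identity $1^F=F$ and $(h^F)^*=(h^* )^F$. Centre: $Z(H):=\{h\in H: hx=xh \text{ for all } x\in H,\ h^*h=\{1\}\}$. Upper center series: $Z_0(H)=\{1\}$, and for $i\ge1$, $Z_i(H)$ is determined by $Z_i(H)//Z_{i-1}(H)=Z(H//Z_{i-1}(H))$,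 i.e. $Z_i(H)=\{h\in H: h^{Z_{i-1}(H)}\in Z(H//Z_{i-1}(H))\}$; each $Z_i(H)$ is a normal closed subset of $H$. A hypergroup $H$ is weakly nilpotent if $Z_n(H)=H$ for some non-negative integer $n$. *)

(* Defs.v *)
From mathcomp Require Import all_boot.
From mathcomp Require Import boolp classical_sets.

Set Implicit Arguments.
Unset Strict Implicit.
Unset Printing Implicit Defensive.

Local Open Scope classical_set_scope.

Definition setop (T : Type) (op : T -> T -> set T) (P Q : set T) : set T :=
  \bigcup_(p in P) \bigcup_(q in Q) op p q.

(* The identity and the inverses are data rather than existence statements; the
   axioms determine them, see [h1_uniq] and [hstar_uniq]. *)
Record hypergroup : Type := Hypergroup {
  hsort :> Type;
  hmul : hsort -> hsort -> set hsort;
  h1 : hsort;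
  hstar : hsort -> hsort;
  hmulA : forall p q r : hsort,
    setop hmul [set p] (hmul q r) = setop hmul (hmul p q) [set r];
  hmul1 : forall s : hsort, hmul s h1 = [set s];
  hmul_star : forall p q r : hsort, hmul p q r ->
    setop hmul [set hstar p] [set r] q /\ setop hmul [set r] [set hstar q] p }.

Arguments h1 {h}.

Declare Scope hypergroup_scope.
Delimit Scope hypergroup_scope with H.
Local Open Scope hypergroup_scope.

Definition hprod (H : hypergroup) (P Q : set H) : set H := setop (@hmul H) P Q.
Notation "P ** Q" := (hprod P Q) (at level 40, left associativity)
  : hypergroup_scope.

Definition hclosed (H : hypergroup) (F : set H) : Prop :=
  F !=set0 /\ (@hstar H @` F) ** F `<=` F.

Section Basics.
Variable H : hypergroup.
Implicit Types (P Q R : set H) (p q r s x y : H).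

Lemma hprodP P Q r :
  (P ** Q) r <-> exists p q, [/\ P p, Q q & hmul p q r].
Proof.
split; first by move=> [p Pp [q Qq pqr]]; exists p, q.
by move=> [p [q [Pp Qq pqr]]]; exists p => //; exists q.
Qed.

Lemma hprod11 p q : [set p] ** [set q] = hmul p q.
Proof. by rewrite /hprod /setop !bigcup_set1. Qed.

Lemma hmul_starl p q r : hmul p q r -> hmul (hstar p) r q.
Proof. by move=> /hmul_star[+ _]; rewrite -hprod11. Qed.

Lemma hmul_starr p q r : hmul p q r -> hmul r (hstar q) p.
Proof. by move=> /hmul_star[_]; rewrite -hprod11. Qed.

Lemma hmulA_l p q r x y : hmul p q x -> hmul x r y ->
  exists2 z, hmul q r z & hmul p z y.
Proof.
move=> pqx xry; have : setop (@hmul H) (hmul p q) [set r] y.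
  by exists x => //; exists r.
by rewrite -hmulA => -[_ -> [z qrz pzy]]; exists z.
Qed.

Lemma hmulA_r p q r x y : hmul q r x -> hmul p x y ->
  exists2 z, hmul p q z & hmul z r y.
Proof.
move=> qrx pxy; have : setop (@hmul H) [set p] (hmul q r) y.
  by exists p => //; exists x.
by rewrite hmulA => -[z pqz [_ -> zry]]; exists z.
Qed.

Lemma hprodA P Q R : P ** (Q ** R) = P ** Q ** R.
Proof.
apply/seteqP; split => y.
  move=> /hprodP[p [x [Pp /hprodP[q [r [Qq Rr qrx]]] pxy]]].
  have [z pqz zry] := hmulA_r qrx pxy.
  by apply/hprodP; exists z, r; split=> //; apply/hprodP; exists p, q.
move=> /hprodP[x [r [/hprodP[p [q [Pp Qq pqx]]] Rr xry]]].
have [z qrz pzy] := hmulA_l pqx xry.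
by apply/hprodP; exists p, z; split=> //; apply/hprodP; exists q, r.
Qed.

Lemma hprodS P P' Q Q' : P `<=` P' -> Q `<=` Q' -> P ** Q `<=` P' ** Q'.
Proof.
move=> sP sQ r /hprodP[p [q [/sP Pp /sQ Qq pqr]]].
by apply/hprodP; exists p, q.
Qed.

Lemma hmulx1 s : hmul s h1 s. Proof. by rewrite hmul1. Qed.

Lemma hmulx1E s x : hmul s h1 x -> x = s.
Proof. by rewrite hmul1. Qed.

Lemma hmulVx s : hmul (hstar s) s h1.
Proof. exact: hmul_starl (hmulx1 s). Qed.

Lemma hstarK s : hstar (hstar s) = s.
Proof. by have /hmul_starl/hmulx1E := hmulVx s. Qed.

Lemma hstar1 : hstar h1 = h1 :> H.
Proof. exact/esym/hmulx1E/hmulVx. Qed.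

Lemma hmulxV s : hmul s (hstar s) h1.
Proof. by have := hmulVx (hstar s); rewrite hstarK. Qed.

Lemma hmul1xE s x : hmul h1 s x -> x = s.
Proof.
move=> /hmul_starr /hmul_starl /hmulx1E E.
by rewrite -(hstarK s) E hstarK.
Qed.

Lemma hmul1x s : hmul h1 s s.
Proof. by have /hmul_starr := hmulxV s; rewrite hstarK. Qed.

Lemma hmul1l s : hmul h1 s = [set s].
Proof.
by apply/seteqP; split=> x; [move=> /hmul1xE | move=> ->; exact: hmul1x].
Qed.

Lemma hmul_star_rev p q r : hmul p q r -> hmul (hstar q) (hstar p) (hstar r).
Proof. by move=> /hmul_starl /hmul_starr /hmul_starl. Qed.

Lemma hstar_hprod P Q :
  @hstar H @` (P ** Q) = (@hstar H @` Q) ** (@hstar H @` P).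
Proof.
apply/seteqP; split=> x.
  move=> [y /hprodP[p [q [Pp Qq pqy]]] <-]; apply/hprodP.
  exists (hstar q), (hstar p); split; [by exists q | by exists p |].
  exact: hmul_star_rev.
move=> /hprodP[_ [_ [[q Qq <-] [p Pp <-] /hmul_star_rev]]].
rewrite !hstarK => pqx; exists (hstar x); last by rewrite hstarK.
by apply/hprodP; exists p, q.
Qed.

Lemma h1_uniq e : (forall s, hmul s e = [set s]) -> e = h1.
Proof. by move=> /(_ h1); rewrite hmul1l => /seteqP[/(_ e erefl)]. Qed.

Lemma hstar_uniq s t :
  (forall q r, hmul s q r -> hmul t r q) -> t = hstar s.
Proof.
move=> /(_ _ _ (hmulx1 s)) /hmul_starl /hmulx1E E.
by rewrite E hstarK.
Qed.

Section Closed.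
Variables (F : set H) (FP : hclosed F).

Lemma hclosed_starl x y z : F x -> F y -> hmul (hstar x) y z -> F z.
Proof.
case: FP => _ sF Fx Fy xyz; apply: sF; apply/hprodP.
by exists (hstar x), y; split=> //; exists x.
Qed.

Lemma hclosed1 : F h1.
Proof.
by case: (FP) => -[x Fx] _; exact: (hclosed_starl Fx Fx (hmulVx x)).
Qed.

Lemma hclosed_star x : F x -> F (hstar x).
Proof. by move=> Fx; exact: hclosed_starl Fx hclosed1 (hmulx1 _). Qed.

Lemma hclosed_mul x y z : F x -> F y -> hmul x y z -> F z.
Proof.
by move=> /hclosed_star Fx Fy; rewrite -{1}(hstarK x); exact: hclosed_starl.
Qed.

Lemma hclosed_image_star : @hstar H @` F = F.
Proof.
apply/seteqP; split=> [_ [x Fx <-]|x Fx]; first exact: hclosed_star.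
by exists (hstar x); [exact: hclosed_star | exact: hstarK].
Qed.

Lemma hclosed_prod : F ** F = F.
Proof.
apply/seteqP; split=> x.
  by move=> /hprodP[p [q [Fp Fq]]]; exact: hclosed_mul.
by move=> Fx; apply/hprodP; exists x, h1; split=> //;
  [exact: hclosed1 | exact: hmulx1].
Qed.

End Closed.

Lemma hclosed_set1 : hclosed [set h1 : H].
Proof.
split; first by exists h1.
by move=> x /hprodP[_ [_ [[_ -> <-] ->]]]; rewrite hstar1 hmul1.
Qed.

End Basics.

Section SubHypergroup.
Variables (H : hypergroup) (F : set H) (FP : hclosed F).

Definition sub_mul (x y : F) : set F := [set z | hmul (val x) (val y) (val z)].
Definition sub_one : F := SigSub (mem_set (hclosed1 FP)).
Definition sub_star (x : F) : F :=
  SigSub (mem_set (hclosed_star FP (set_valP x))).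

Fact sub_mulA (p q r : F) :
  setop sub_mul [set p] (sub_mul q r) = setop sub_mul (sub_mul p q) [set r].
Proof.
apply/seteqP; split=> y.
  move=> [_ -> [x qrx pxy]]; have [z pqz zry] := hmulA_r qrx pxy.
  have Fz := hclosed_mul FP (set_valP p) (set_valP q) pqz.
  by exists (SigSub (mem_set Fz)) => //; exists r.
move=> [x pqx [_ -> xry]]; have [z qrz pzy] := hmulA_l pqx xry.
have Fz := hclosed_mul FP (set_valP q) (set_valP r) qrz.
by exists p => //; exists (SigSub (mem_set Fz)).
Qed.

Fact sub_mul1 (s : F) : sub_mul s sub_one = [set s].
Proof.
apply/seteqP; split=> x; first by move=> /hmulx1E /val_inj.
by move=> ->; exact: hmulx1.
Qed.

Fact sub_mul_star (p q r : F) : sub_mul p q r ->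
  setop sub_mul [set sub_star p] [set r] q /\
  setop sub_mul [set r] [set sub_star q] p.
Proof.
rewrite /setop !bigcup_set1 => pqr.
by split; [exact: hmul_starl pqr | exact: hmul_starr pqr].
Qed.

Definition sub_hypergroup : hypergroup :=
  Hypergroup sub_mulA sub_mul1 sub_mul_star.

End SubHypergroup.

Definition dcoset (H : hypergroup) (F : set H) (h : H) : set H :=
  F ** [set h] ** F.

Section Quotient.
Variables (H : hypergroup) (F : set H) (FP : hclosed F).
Implicit Types (a b c h x y : H).

Lemma dcosetP h x : dcoset F h x <->
  exists f g y, [/\ F f, F g, hmul f h y & hmul y g x].
Proof.
rewrite /dcoset; split.
  by move=> /hprodP[y [g [/hprodP[f [_ [Ff -> fhy]]] Fg ygx]]]; exists f, g, y.
move=> [f [g [y [Ff Fg fhy ygx]]]]; apply/hprodP; exists y, g; split=> //.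
by apply/hprodP; exists f, h.
Qed.

Lemma dcoset_refl h : dcoset F h h.
Proof.
apply/dcosetP; exists h1, h1, h.
by split; [exact: hclosed1 | exact: hclosed1 | exact: hmul1x | exact: hmulx1].
Qed.

Lemma dcoset_sym x y : dcoset F x y -> dcoset F y x.
Proof.
move=> /dcosetP[f [g [z [Ff Fg fxz zgy]]]].
have zx := hmul_starl fxz; have [t ft tx] := hmulA_r (hmul_starr zgy) zx.
by apply/dcosetP; exists (hstar f), (hstar g), t;
  split=> //; exact: hclosed_star.
Qed.

Lemma dcoset_sat x : F ** dcoset F x ** F = dcoset F x.
Proof.
by rewrite /dcoset !hprodA hclosed_prod // -hprodA hclosed_prod.
Qed.

Lemma dcoset_sub x y : dcoset F x y -> dcoset F y `<=` dcoset F x.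
Proof.
move=> xy; rewrite -(dcoset_sat x).
by apply: hprodS => //; apply: hprodS => // _ ->.
Qed.

Lemma dcoset_eq x y : dcoset F x = dcoset F y <-> dcoset F y x.
Proof.
split=> [<-|yx]; first exact: dcoset_refl.
by apply/seteqP; split; apply: dcoset_sub => //; exact: dcoset_sym.
Qed.

Lemma dcoset1 : dcoset F h1 = F.
Proof.
suff E : F ** [set h1] = F by rewrite /dcoset E hclosed_prod.
apply/seteqP; split=> x; first by move=> /hprodP[y [_ [Fy -> /hmulx1E ->]]].
by move=> Fx; apply/hprodP; exists x, h1; split=> //; exact: hmulx1.
Qed.

Lemma dcoset_star h : @hstar H @` dcoset F h = dcoset F (hstar h).
Proof.
by rewrite /dcoset !hstar_hprod image_set1 (hclosed_image_star FP) hprodA.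
Qed.

Definition quotient_set : set (set H) := [set dcoset F h | h in setT].

Definition qclass (h : H) : quotient_set :=
  SigSub (mem_set (imageP (dcoset F) (I : setT h))).

Lemma qclass_eq x y : qclass x = qclass y <-> dcoset F y x.
Proof.
rewrite -dcoset_eq; split=> [/(congr1 val)//|E]; exact: val_inj.
Qed.

Lemma qclass_surj (A : quotient_set) : exists a, A = qclass a.
Proof.
by have [a _ E] := set_valP A; exists a; apply: val_inj; rewrite /= E.
Qed.

(* The union over all representatives of A and B, which is the same as the set
   given by any one choice of them: see [quo_mul_qclass]. *)
Definition quo_mul (A B : quotient_set) : set quotient_set :=
  [set C | exists a b x, [/\ A = qclass a, B = qclass b,
     ([set a] ** F ** [set b]) x & C = qclass x]].

Definition quo_one : quotient_set := qclass h1.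

Fact quo_star_subproof (A : quotient_set) : quotient_set (@hstar H @` val A).
Proof. by have [a ->] := qclass_surj A; rewrite dcoset_star; exists (hstar a). Qed.

(* The elementwise inverse of the double coset; on classes it is
   [quo_star_qclass]. *)
Definition quo_star (A : quotient_set) : quotient_set :=
  SigSub (mem_set (quo_star_subproof A)).

Lemma quo_star_qclass h : quo_star (qclass h) = qclass (hstar h).
Proof. by apply: val_inj; rewrite /= dcoset_star. Qed.

Lemma dcoset_prod a b :
  dcoset F a ** dcoset F b = F ** ([set a] ** F ** [set b]) ** F.
Proof. by rewrite /dcoset !hprodA -(hprodA _ F F) hclosed_prod. Qed.

Lemma quo_mulP a b x : quo_mul (qclass a) (qclass b) (qclass x) <->
  (dcoset F a ** dcoset F b) x.
Proof.
split.
  move=> [c [d [y [/qclass_eq ca /qclass_eq db cdy /qclass_eq yx]]]].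
  suff : (dcoset F c ** dcoset F d) x.
    by apply: hprodS; apply: dcoset_sub; exact: dcoset_sym.
  by rewrite dcoset_prod; move: yx; apply: hprodS => //; apply: hprodS => // _ ->.
rewrite dcoset_prod => /hprodP[z [g [/hprodP[f [y [Ff aby fyz]]] Fg zgx]]].
exists a, b, y; split=> //; apply/qclass_eq/dcosetP.
by exists f, g, z.
Qed.

Lemma quo_mul_qclass a b : quo_mul (qclass a) (qclass b) =
  [set qclass x | x in [set a] ** F ** [set b]].
Proof.
apply/seteqP; split=> C; last first.
  by move=> [x abx <-]; exists a, b, x.
have [x ->] := qclass_surj C; move=> /quo_mulP.
rewrite dcoset_prod => /hprodP[z [g [/hprodP[f [y [Ff aby fyz]]] Fg zgx]]].
by exists y => //; apply/esym/qclass_eq/dcosetP; exists f, g, z.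
Qed.

Fact quo_mulA (A B C : quotient_set) :
  setop quo_mul [set A] (quo_mul B C) = setop quo_mul (quo_mul A B) [set C].
Proof.
have [a ->] := qclass_surj A; have [b ->] := qclass_surj B.
have [c ->] := qclass_surj C.
have sat x y : F ** (dcoset F x ** dcoset F y) ** F = dcoset F x ** dcoset F y.
  rewrite /dcoset !hprodA hclosed_prod //.
  by rewrite -(hprodA _ F F) hclosed_prod.
have satS (P : set H) z : F ** P ** F = P -> P z -> dcoset F z `<=` P.
  by move=> E Pz; rewrite -E; do 2!apply: hprodS => //; move=> _ ->.
apply/seteqP; split=> D; have [x ->] := qclass_surj D.
  move=> [_ -> [Y]]; have [y ->] := qclass_surj Y => /quo_mulP bcy /quo_mulP.
  move=> /(hprodS (@subset_refl _ _) (satS _ _ (sat b c) bcy)).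
  rewrite hprodA => /hprodP[z [t [abz ct ztx]]].
  exists (qclass z); first exact/quo_mulP.
  exists (qclass c) => //; apply/quo_mulP/hprodP.
  by exists z, t; split=> //; exact: dcoset_refl.
move=> [Y]; have [y ->] := qclass_surj Y => /quo_mulP aby [_ ->] /quo_mulP.
move=> /(hprodS (satS _ _ (sat a b) aby) (@subset_refl _ _)).
rewrite -hprodA => /hprodP[z [t [az bct ztx]]].
exists (qclass a) => //; exists (qclass t); first exact/quo_mulP.
apply/quo_mulP/hprodP; exists z, t; split=> //; exact: dcoset_refl.
Qed.

Fact quo_mul1 (A : quotient_set) : quo_mul A quo_one = [set A].
Proof.
have [a ->] := qclass_surj A.
have E : dcoset F a ** dcoset F h1 = dcoset F a.
  by rewrite dcoset1 /dcoset -hprodA hclosed_prod.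
apply/seteqP; split=> C; have [x ->] := qclass_surj C.
  by move=> /quo_mulP; rewrite E => /qclass_eq.
by move=> /qclass_eq; rewrite -E => /quo_mulP.
Qed.

Fact quo_mul_star (A B C : quotient_set) : quo_mul A B C ->
  setop quo_mul [set quo_star A] [set C] B /\
  setop quo_mul [set C] [set quo_star B] A.
Proof.
have [a ->] := qclass_surj A; have [b ->] := qclass_surj B.
have [c ->] := qclass_surj C.
rewrite /setop !bigcup_set1 !quo_star_qclass.
move=> /quo_mulP /hprodP[x [y [ax bY xyc]]]; split.
  have -> : qclass b = qclass y by apply/esym/qclass_eq.
  apply/quo_mulP/hprodP; exists (hstar x), c; split.
  - by rewrite -dcoset_star; exists x.
  - exact: dcoset_refl.
  - exact: hmul_starl xyc.
have -> : qclass a = qclass x by apply/esym/qclass_eq.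
apply/quo_mulP/hprodP; exists c, (hstar y); split.
- exact: dcoset_refl.
- by rewrite -dcoset_star; exists y.
- exact: hmul_starr xyc.
Qed.

Definition quotient_hypergroup : hypergroup :=
  Hypergroup quo_mulA quo_mul1 quo_mul_star.

End Quotient.

Definition hcenter (H : hypergroup) : set H :=
  [set h | (forall x : H, hmul h x = hmul x h) /\ hmul (hstar h) h = [set h1]].

Lemma hcenter_closed (H : hypergroup) : hclosed (@hcenter H).
Proof.
have star (a : H) : hcenter a -> hcenter (hstar a).
  move=> [ca a1]; split=> [x|]; last by rewrite hstarK ca a1.
  apply/seteqP; split=> y /hmul_star_rev; rewrite hstarK.
    by rewrite -ca => /hmul_star_rev; rewrite !hstarK.
  by rewrite ca => /hmul_star_rev; rewrite !hstarK.
have sing (a x y y' : H) : hcenter a -> hmul a x y -> hmul a x y' -> y = y'.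
  move=> [ca a1] axy axy'.
  have yx := hmul_starl axy; have [t aat ty'] := hmulA_r yx axy'.
  have : hmul (hstar a) a t by rewrite -ca.
  by rewrite a1 => t1; move: ty'; rewrite t1 => /hmul1xE.
split.
  exists h1; split=> [x|]; first by rewrite hmul1 hmul1l.
  by rewrite hstar1 hmul1.
move=> z /hprodP[_ [b [[a Za <-] Zb abz]]].
have Zs := star a Za; have [cs s1] := Zs; have [cb b1] := Zb.
split=> [x|].
  apply/seteqP; split=> y.
    move=> zxy; have [t bxt st] := hmulA_l abz zxy.
    rewrite cb in bxt; have [u sxu uby] := hmulA_r bxt st.
    rewrite cs in sxu; have [v sbv xvy] := hmulA_l sxu uby.
    by rewrite (sing _ _ _ _ Zs abz sbv).
  move=> xzy; have [t xst tby] := hmulA_r abz xzy.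
  rewrite -cs in xst; have [u xbu suy] := hmulA_l xst tby.
  rewrite -cb in xbu; have [v sbv vxy] := hmulA_r xbu suy.
  by rewrite (sing _ _ _ _ Zs abz sbv).
apply/seteqP; split=> y; last by move=> ->; exact: hmulVx.
move=> zzy; have := hmul_star_rev abz; rewrite hstarK => zb.
have [u azu buy] := hmulA_l zb zzy.
have [v aav vbu] := hmulA_r abz azu.
move: aav; rewrite -{1}(hstarK a) s1 => v1.
by move: vbu; rewrite v1 => /hmul1xE ub; move: buy; rewrite ub b1.
Qed.

Lemma qclass_preimage_closed (H : hypergroup) (F : set H) (FP : hclosed F)
    (K : set (quotient_hypergroup FP)) :
  hclosed K -> hclosed [set h | K (qclass F h)].
Proof.
move=> KP; split; first by exists h1; exact: hclosed1 KP.
move=> z /hprodP[_ [b [[a Ka <-] Kb abz]]].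
apply: (hclosed_starl KP Ka Kb).
rewrite /= quo_star_qclass; apply/(quo_mulP FP)/hprodP.
by exists (hstar a), b; split=> //; exact: dcoset_refl.
Qed.

(* The closedness proof is carried along because the next term needs the
   quotient hypergroup by the current one. *)
Fixpoint upper_center_sig (H : hypergroup) (i : nat) :
    {F : set H | hclosed F} :=
  if i is j.+1 then
    let Z := upper_center_sig H j in
    exist _ [set h | @hcenter (quotient_hypergroup (svalP Z)) (qclass (sval Z) h)]
      (qclass_preimage_closed (hcenter_closed (quotient_hypergroup (svalP Z))))
  else exist _ [set h1] (hclosed_set1 H).

Definition upper_center (H : hypergroup) (i : nat) : set H :=
  sval (upper_center_sig H i).

Lemma upper_center_closed (H : hypergroup) (i : nat) :
  hclosed (@upper_center H i).
Proof. exact: svalP. Qed.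

Lemma upper_center0 (H : hypergroup) : upper_center 0 = [set h1 : H].
Proof. by []. Qed.

Lemma upper_centerS (H : hypergroup) (i : nat)
    (ZP : hclosed (@upper_center H i)) :
  upper_center i.+1 =
  [set h | @hcenter (quotient_hypergroup ZP) (qclass (upper_center i) h)].
Proof. by rewrite (Prop_irrelevance ZP (svalP (upper_center_sig H i))). Qed.

Definition weakly_nilpotent (H : hypergroup) : Prop :=
  exists n : nat, @upper_center H n = setT.

(* Main.v *)
Require Import Defs.
From mathcomp Require Import all_boot.
From mathcomp Require Import boolp classical_sets.

(** Each term of the upper central series of [H] meets a closed subset [N] inside
    the corresponding term of the upper central series of [N]; so if the series
    of [H] reaches [H] after [n] steps, that of [N] has reached [N] by then.

    The inclusion is proved by induction, and for that the condition that [h^F]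
    is central in [H//F] is rewritten without quotients.  When [F] is normal, the
    double coset [FhF] is just [hF], so multiplying classes is multiplying in [H]
    and absorbing [F] on the right.  Hence [h^F] is central if and only if
    [h^*h] lies in [F] and [hxF = xhF] for all [x]: see [hcenter_quotient].

    Two things follow from this description.  The next term of the series is again
    normal, since [hx] lies in [xhF], which lies in [x] times the next term: see
    [upper_center_normal].  And the condition restricts to [N] with [F] replaced
    by any closed subset [W] of [N] containing [F] meet [N]: if [h] and [x] are in
    [N], an element [y] of [hx] lies in [uf] with [u] in [xh] and [f] in [F], and
    then [f] belongs to [u^*y], a subset of [N], so that [f] is in [W]: see
    [hmul_comm_mod_restrict]. *)

Set Implicit Arguments.
Unset Strict Implicit.
Unset Printing Implicit Defensive.

Local Open Scope classical_set_scope.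
Local Open Scope hypergroup_scope.

Definition hnormal (H : hypergroup) (F : set H) : Prop :=
  forall h : H, F ** [set h] `<=` [set h] ** F.

Lemma hprod_subabsorb (H : hypergroup) (F P Q : set H) : hclosed F ->
  P `<=` Q ** F -> P ** F `<=` Q ** F.
Proof.
move=> FP sPQ; have : P ** F `<=` Q ** F ** F by exact: hprodS.
by rewrite -hprodA hclosed_prod.
Qed.

Lemma sub_hprodr (H : hypergroup) (F P : set H) : hclosed F -> P `<=` P ** F.
Proof.
move=> FP x Px; apply/hprodP; exists x, h1; split=> //.
  exact: hclosed1.
exact: hmulx1.
Qed.

Section NormalQuotient.
Variables (H : hypergroup) (F : set H) (FP : hclosed F) (nF : hnormal F).

(** The inverse map reverses products, so it turns the inclusion [F h^* <= h^* F]
    into the missing inclusion [h F <= F h]. *)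
Lemma hnormal_comm (h : H) : F ** [set h] = [set h] ** F.
Proof.
apply/seteqP; split; first exact: nF.
have := @image_subset _ _ (@hstar H) _ _ (@nF (hstar h)).
by rewrite !hstar_hprod !image_set1 hstarK (hclosed_image_star FP).
Qed.

Lemma dcoset_normal (h : H) : dcoset F h = [set h] ** F.
Proof. by rewrite /dcoset hnormal_comm -hprodA hclosed_prod. Qed.

Lemma quo_mul_normal (a b x : H) :
  quo_mul (qclass F a) (qclass F b) (qclass F x) <-> (hmul a b ** F) x.
Proof.
apply: (iff_trans (quo_mulP FP a b x)).
by rewrite !dcoset_normal hprodA -(hprodA [set a]) hnormal_comm !hprodA
  -(hprodA _ F F) hclosed_prod // hprod11.
Qed.

(** Sets of the form [PF] are unions of classes [xF], so an equation between sets
    of classes is the same as one between their unions; and [h^*hF = F] only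
    needs [h^*h] to be inside [F], since [1] is in [h^*h]. *)
Lemma hcenter_quotient (h : H) :
  @hcenter (quotient_hypergroup FP) (qclass F h) <->
  (forall x, hmul h x ** F = hmul x h ** F) /\ hmul (hstar h) h `<=` F.
Proof.
have oneE x : [set @quo_one H F] (qclass F x) <-> F x.
  by split; [move=> /(qclass_eq FP) | move=> Fx; apply/(qclass_eq FP)];
    rewrite dcoset1.
split=> -[comm inv]; split.
- move=> x; have /seteqP[s1 s2] := comm (qclass F x).
  by apply/seteqP; split=> y; rewrite -!quo_mul_normal; [exact: s1 | exact: s2].
- move=> y /(sub_hprodr FP) /quo_mul_normal; rewrite -(quo_star_qclass FP) => my.
  by apply/oneE; rewrite -[X in X _]inv.
- move=> X; have [x ->] := qclass_surj X.
  apply/seteqP; split=> Y; have [y ->] := qclass_surj Y;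
    by move=> /quo_mul_normal hy; apply/quo_mul_normal; move: hy; rewrite comm.
- rewrite /= quo_star_qclass; apply/seteqP; split=> Y.
    have [y ->] := qclass_surj Y; move=> /quo_mul_normal hy; apply/oneE.
    by rewrite -(hclosed_prod FP); exact: hprodS hy.
  by move=> ->; apply/quo_mul_normal/(sub_hprodr FP)/hmulVx.
Qed.

End NormalQuotient.

Lemma sub_upper_centerS (H : hypergroup) (i : nat) :
  @upper_center H i `<=` upper_center i.+1.
Proof.
have ZP := upper_center_closed H i.
move=> h Zh; rewrite (upper_centerS ZP) /=.
suff -> : qclass (upper_center i) h = h1 :> quotient_hypergroup ZP.
  exact: hclosed1 (hcenter_closed _).
by apply/(qclass_eq ZP); rewrite dcoset1.
Qed.

(** For [z] in term [i+1], commutation modulo term [i] gives [zh <= hzZ_i], and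
    [zZ_i] stays in term [i+1] because the series increases. *)
Lemma upper_center_normal (H : hypergroup) (i : nat) :
  hnormal (@upper_center H i).
Proof.
elim: i => [|i nZ] h.
  by rewrite upper_center0 !hprod11 hmul1 hmul1l.
have ZP := upper_center_closed H i.
move=> y /hprodP[z [_ [Zz -> zhy]]]; have := Zz.
rewrite {1}(upper_centerS ZP) => /(hcenter_quotient ZP nZ)[comm _].
have : (hmul z h ** upper_center i) y by exact: (sub_hprodr ZP).
rewrite comm -hprod11 -hprodA; apply: hprodS => //.
rewrite -(hclosed_prod (upper_center_closed H i.+1)).
by apply: hprodS; [move=> _ -> | exact: sub_upper_centerS].
Qed.

Lemma mem_upper_centerS (H : hypergroup) (i : nat) (h : H) :
  upper_center i.+1 h <->
  (forall x, hmul h x ** upper_center i = hmul x h ** upper_center i) /\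
  hmul (hstar h) h `<=` upper_center i.
Proof.
have ZP := upper_center_closed H i.
rewrite (upper_centerS ZP).
exact: hcenter_quotient (@upper_center_normal H i) h.
Qed.

Section Restriction.
Variables (H : hypergroup) (N : set H) (hN : hclosed N).

(** If [y] is in [uf] with [u] and [y] in [N], then [f] is in [u^*y], so in [N].
    The error term in [Z] thus lies in [N], where [Z] is bounded by [W]. *)
Lemma hmul_comm_mod_restrict (Z : set H) (W : set (sub_hypergroup hN)) :
  hclosed Z -> (forall x : N, Z (val x) -> W x) ->
  forall a b : sub_hypergroup hN,
  hmul (val (a : N)) (val (b : N)) ** Z = hmul (val (b : N)) (val (a : N)) ** Z ->
  hmul a b `<=` hmul b a ** W.
Proof.
move=> ZP sZW a b comm y aby.
have : (hmul (val (a : N)) (val (b : N)) ** Z) (val (y : N)).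
  exact: (sub_hprodr ZP).
rewrite comm => /hprodP[u [f [bau Zf ufy]]].
have Nu : N u := hclosed_mul hN (set_valP (b : N)) (set_valP (a : N)) bau.
have Nf : N f := hclosed_starl hN Nu (set_valP (y : N)) (hmul_starl ufy).
apply/hprodP; exists (SigSub (mem_set Nu)), (SigSub (mem_set Nf)).
by split=> //; exact: sZW.
Qed.

Lemma upper_center_restrict (i : nat) (x : N) :
  @upper_center H i (val x) -> @upper_center (sub_hypergroup hN) i x.
Proof.
elim: i x => [|i IH] x; first by move=> Zx; exact: val_inj.
have ZP := upper_center_closed H i.
have WP := upper_center_closed (sub_hypergroup hN) i.
move=> /mem_upper_centerS[comm inv]; apply/mem_upper_centerS; split=> [y|y].
  by apply/seteqP; split; apply: (hprod_subabsorb WP);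
    apply: (hmul_comm_mod_restrict ZP IH); rewrite comm.
by move=> /inv; exact: IH.
Qed.

End Restriction.

Theorem theorem1p6 (H : hypergroup) (N : set H) (hH : weakly_nilpotent H)
  (hN : hclosed N) : weakly_nilpotent (sub_hypergroup hN).
Proof.
have [n Zn] := hH; exists n; apply/seteqP; split=> // x _.
by apply: upper_center_restrict; rewrite Zn.
Qed.
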